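(* For integers $n,m \geq 1$ and $i \geq 0$, the total number of vertices of outdegree $i$ among all plane trees with $n$ edges whose root has degree $m$ is $$m\binom{2n-m-i-2}{n-2}\quad\text{when } i\neq m,$$ and $$m\binom{2n-2m-2}{n-2}+\frac{m}{n}\binom{2n-m-1}{n-1}\quad\text{when } i=m.$$
   Context: A plane tree is a rooted tree whose vertices are considered to be indistinguishable (unlabelled), but in which the subtrees at any vertex are linearly ordered. A vertex has outdegree $i$ if it has $i$ subtrees (children). The degree of a vertex is the total number of vertices adjacent to it; for the root, the degree equals the outdegree. The total number of vertices of outdegree $i$ among a set of trees means the number of pairs $(T,v)$ where $T$ is a tree in the set and $v$ is a vertex of $T$ (possibly the root) of outdegree $i$. *)

(* Defs.v *)
From mathcomp Require Import all_boot all_order all_algebra.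
From mathcomp Require Import all_classical.

Set Implicit Arguments.
Unset Strict Implicit.
Unset Printing Implicit Defensive.

Local Open Scope classical_set_scope.

Inductive plane_tree := Node of seq plane_tree.

Definition children (T : plane_tree) : seq plane_tree := let: Node s := T in s.

Definition outdegree (T : plane_tree) : nat := size (children T).

Fixpoint num_edges (T : plane_tree) : nat :=
  let: Node s := T in sumn [seq (num_edges t).+1 | t <- s].

(* A vertex of T is encoded by its address: the sequence of child positions   *)
(* (from 0) followed from the root, which is itself [::].  subtree_at T v is  *)
(* the subtree rooted at v, or None when v is not the address of a vertex.    *)
Fixpoint subtree_at (T : plane_tree) (v : seq nat) : option plane_tree :=
  if v is k :: v' then
    if onth (children T) k is Some t then subtree_at t v' else None
  else Some T.

Definition is_vertex_of_outdegree (i : nat) (T : plane_tree) (v : seq nat) :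
  Prop := exists2 S, subtree_at T v = Some S & outdegree S = i.

Definition outdegree_pairs (n m i : nat) : set (plane_tree * seq nat) :=
  [set Tv | [/\ num_edges Tv.1 = n, outdegree Tv.1 = m
              & is_vertex_of_outdegree i Tv.1 Tv.2]].

(* Integer binomial coefficients under the convention of path and composition *)
(* counting: C(a, a) = 1 for every a, and otherwise C(a, b) = 0 unless        *)
(* 0 <= b <= a.  In particular C(-1, 0) = 0, unlike the polynomial convention *)
(* a(a-1)...(a-b+1)/b!, and C(-1, -1) = 1, the number of compositions of 0    *)
(* into 0 parts.                                                              *)
Definition binz (a b : int) : nat :=
  if a == b then 1 else
  match a, b with
  | Posz a', Posz b' => 'C(a', b')
  | _, _ => 0
  end.

(* Main.v *)
(** Deleting the first root of a plane forest and promoting its [d] children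
    turns a forest of [m + 1] trees with [n + 1] vertices into a forest of
    [m + d] trees with [n] vertices, and every such forest arises once for each
    [d].  Write F(m, n) for the number of forests with [m] trees and [n]
    vertices, and W(m, n) for the number of their vertices of outdegree [i].
    Telescoping the resulting sums over [d] gives
      F(m+1, n+1) = F(m, n) + F(m+2, n+1),
      W(m+1, n+1) = W(m, n) + W(m+2, n+1) + F(m+i, n) - F(m+i+1, n),
    which determine F and W; the binomial formulas satisfy the same relations
    by Pascal's rule.  A plane tree with [n] edges and root degree [m] is a
    forest of [m] trees with [n] vertices together with a root, which
    contributes F(m, n) to the count when [i = m]. *)

From HB Require Import structures.
Require Import Defs.
From mathcomp Require Import all_boot all_order all_algebra.
From mathcomp Require Import all_classical finmap.
From mathcomp Require Import zify ring.

Import Order.TTheory GRing.Theory Num.Theory.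

(** * Trees and their vertices of given outdegree *)

HB.instance Definition _ := gen_eqMixin plane_tree.
HB.instance Definition _ := gen_choiceMixin plane_tree.

Lemma plane_tree_mem_ind (P : plane_tree -> Prop) :
  (forall s, {in s, forall t, P t} -> P (Node s)) -> forall T, P T.
Proof.
move=> step; fix IH 1; case=> s; apply: step.
elim: s => [u|t s IHs u]; first by rewrite in_nil; discriminate.
(* The guarded call [IH t] is made once and [IH] is cleared, so that closing tactics cannot apply it
   to a non-subterm. *)
by have Pt := IH t; clear IH; rewrite inE => /orP[/eqP -> | /IHs].
Qed.

Fixpoint vertices_of_outdegree (i : nat) (T : plane_tree) : seq (seq nat) :=
  let: Node s := T in
  let vs := [seq vertices_of_outdegree i t | t <- s] in
  nseq (size s == i) [::]
    ++ [seq k :: v | k <- iota 0 (size s), v <- nth [::] vs k].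

Lemma mem_vertices_of_outdegree i T v :
  v \in vertices_of_outdegree i T <-> is_vertex_of_outdegree i T v.
Proof.
elim: v T => [|k v IHv] [s] /=; rewrite mem_cat mem_nseq.
  rewrite eqxx andbT lt0b; split=> [/orP[/eqP <-|/allpairsPdep[? [? []]]]|] //.
    by exists (Node s).
  by case=> _ [<-] /eqP; rewrite /outdegree /= => ->.
rewrite andbF /=; split.
  case/allpairsPdep=> l [w [lt_ks v_in [eq_k eq_v]]]; move: lt_ks v_in.
  rewrite -eq_k -eq_v mem_iota /= add0n => lt_ks.
  rewrite (nth_map (Node [::])) // => /IHv[S vS dS].
  exists S => //=; move: lt_ks; rewrite -onthTE.
  by case def_t: (onth s k) vS => [t|] //; rewrite (onth_nth (Node [::]) _ _ _ def_t).
case=> S /=; case def_t: (onth s k) => [t|] // vS dS.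
have lt_ks : k < size s by rewrite -onthTE def_t.
apply/allpairsPdep; exists k, v; split=> //; first by rewrite mem_iota.
rewrite (nth_map (Node [::])) // (onth_nth (Node [::]) _ _ _ def_t).
by apply/IHv; exists S.
Qed.

Lemma uniq_vertices_of_outdegree i T : uniq (vertices_of_outdegree i T).
Proof.
elim/plane_tree_mem_ind: T => s IHs /=; rewrite cat_uniq.
apply/and3P; split; first by case: eqP.
  by apply/hasPn=> _ /allpairsPdep[k [v [_ _ ->]]]; rewrite mem_nseq andbF.
apply: allpairs_uniq_dep => [|k|]; first exact: iota_uniq.
  rewrite mem_iota /= add0n => lt_ks.
  by rewrite (nth_map (Node [::])) //; apply/IHs/mem_nth.
by move=> [k v] [l w] _ _ /= [-> ->].
Qed.

(** * Enumeration of plane forests *)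

Definition forest_count (i : nat) (s : seq plane_tree) : nat :=
  \sum_(t <- s) size (vertices_of_outdegree i t).

Lemma size_vertices_of_outdegree i s :
  size (vertices_of_outdegree i (Node s)) = (size s == i) + forest_count i s.
Proof.
rewrite /= size_cat size_nseq size_allpairs_dep; congr (_ + _).
rewrite sumnE big_map -[in RHS](mkseq_nth (Node [::]) s) /forest_count big_map.
rewrite [LHS]big_seq [RHS]big_seq; apply: eq_bigr => k.
by rewrite mem_iota => lt_ks; rewrite (nth_map (Node [::])).
Qed.

(** Inverse of the promotion: the first [d] trees of [s] go back under a new root. The bound
    [d <= n'] loses nothing, as a forest has at least as many vertices as trees. *)
Fixpoint forests (m n : nat) : seq (seq plane_tree) :=
  match m, n with
  | 0, 0 => [:: [::]]
  | m'.+1, n'.+1 =>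
      [seq Node (take d s) :: drop d s | d <- iota 0 n'.+1, s <- forests (m' + d) n']
  | _, _ => [::]
  end.

Lemma size_le_num_edges s : size s <= num_edges (Node s).
Proof. by elim: s => //= t s IHs; rewrite addSn ltnS (leq_trans IHs) ?leq_addl. Qed.

Lemma num_edges_cat s1 s2 :
  num_edges (Node (s1 ++ s2)) = num_edges (Node s1) + num_edges (Node s2).
Proof. by rewrite /= map_cat sumn_cat. Qed.

(** [num_edges (Node s)] counts the vertices of the forest [s]: each has one edge to its parent. *)
Lemma mem_forests m n s :
  (s \in forests m n) = (size s == m) && (num_edges (Node s) == n).
Proof.
elim: n m s => [|n IHn] [|m] s; try by case: s => //= *; rewrite ?andbF.
apply/allpairsPdep/andP.
  case=> d [u [_ + ->]]; rewrite IHn => /andP[/eqP sz_u /eqP <-].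
  rewrite -[in num_edges (Node u)](cat_take_drop d u) num_edges_cat /=.
  by rewrite size_drop sz_u addnK addSn !eqxx.
case: s => [[]//|[c] s] [/eqP[sz_s] /eqP[]]; rewrite -/(num_edges (Node c)).
rewrite -/(num_edges (Node s)) -num_edges_cat => ne_cs.
exists (size c), (c ++ s); rewrite take_size_cat ?drop_size_cat // IHn size_cat.
rewrite sz_s addnC eqxx ne_cs eqxx mem_iota ltnS; split=> //.
by rewrite -ne_cs num_edges_cat (leq_trans (size_le_num_edges c)) ?leq_addr.
Qed.

Lemma forests_eq0 m n : n < m -> forests m n = [::].
Proof.
move=> lt_nm; apply/eqP; rewrite -size_eq0 -leqn0 leqNgt.
apply/negP; case def_f: (forests m n) => [|s f] // _.
have := mem_forests m n s; rewrite def_f mem_head => /esym/andP[/eqP sz /eqP ne].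
by have := size_le_num_edges s; rewrite sz ne leqNgt lt_nm.
Qed.

Lemma uniq_forests m n : uniq (forests m n).
Proof.
elim: n m => [|n IHn] [|m] //.
pose st := [seq @Tagged _ d (fun _ : nat => seq plane_tree) s
             | d <- iota 0 n.+1, s <- forests (m + d) n].
have st_forest p : p \in st -> tagged p \in forests (m + tag p) n.
  by case/allpairsPdep=> d [u [_ u_in ->]].
apply: allpairs_uniq_dep => [|d _|]; [exact: iota_uniq | exact: IHn |].
move=> [d u] [e v] /st_forest + /st_forest /=; rewrite !mem_forests.
move=> /andP[/eqP sz_u _] /andP[/eqP sz_v _] [eq_take eq_drop].
have eq_de: d = e.
  (* [u] has [m + d] trees, so [take d u] has exactly [d]: the outdegree of the first root recovers
     [d]. *)
  move/(congr1 size): eq_take.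
  by rewrite !size_take_min sz_u sz_v !(minn_idPl (leq_addl _ _)).
rewrite -{}eq_de in eq_take eq_drop *; congr (existT _ _ _).
by rewrite -(cat_take_drop d u) eq_take eq_drop cat_take_drop.
Qed.

(** * Recurrences for forests and their vertices *)

Lemma big_forestsS (F : seq plane_tree -> nat) m n :
  \sum_(s <- forests m.+1 n.+1) F s =
    \sum_(d < n.+1) \sum_(s <- forests (m + d) n) F (Node (take d s) :: drop d s).
Proof. by rewrite [LHS]big_allpairs_dep -[iota 0 n.+1]/(index_iota 0 n.+1) big_mkord. Qed.

Definition forest_total (i m n : nat) : nat :=
  \sum_(s <- forests m n) forest_count i s.

(** The telescoping: raising [m] by one removes the first term and adds [F (m.+1 + n) n], which
    vanishes. *)
Lemma sum_forestsE (F : nat -> nat -> nat) m n :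
  (forall k, n < k -> F k n = 0) ->
  \sum_(d < n.+1) F (m + d) n = F m n + \sum_(d < n.+1) F (m.+1 + d) n.
Proof.
move=> F0; rewrite big_ord_recl addn0; congr (_ + _).
rewrite [RHS]big_ord_recr /= F0 ?addn0; last by rewrite ltnS leq_addl.
by apply: eq_bigr => d _; rewrite /bump /= add1n addSnnS.
Qed.

Lemma size_forests_sum m n :
  size (forests m.+1 n.+1) = \sum_(d < n.+1) size (forests (m + d) n).
Proof.
rewrite -sum1_size big_forestsS; apply: eq_bigr => d _; exact: sum1_size.
Qed.

Lemma size_forestsS m n :
  size (forests m.+1 n.+1) = size (forests m n) + size (forests m.+2 n.+1).
Proof.
rewrite !size_forests_sum (sum_forestsE (fun k l => size (forests k l))) //.
by move=> k lt_nk; rewrite forests_eq0.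
Qed.

Lemma forest_total_sum i m n :
  forest_total i m.+1 n.+1 =
    size (forests (m + i) n) + \sum_(d < n.+1) forest_total i (m + d) n.
Proof.
rewrite /forest_total big_forestsS.
(* The new root counts when [d = i]; all other vertices keep their outdegree under promotion. *)
transitivity (\sum_(d < n.+1)
    ((d == i :> nat) * size (forests (m + d) n) + forest_total i (m + d) n)).
  apply: eq_bigr => d _; rewrite -sum1_size big_distrr -big_split /=.
  rewrite [LHS]big_seq [RHS]big_seq; apply: eq_bigr => s.
  rewrite mem_forests => /andP[/eqP sz_s _].
  rewrite muln1 /forest_count big_cons size_vertices_of_outdegree.
  rewrite size_take_min sz_s (minn_idPl (leq_addl _ _)) -addnA; congr (_ + _).
  by rewrite /forest_count -big_cat cat_take_drop.
rewrite big_split; congr (_ + _) => /=.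
have [lt_in | le_ni] := ltnP i n.+1.
  rewrite (bigD1 (Ordinal lt_in)) //= eqxx mul1n big1 ?addn0 // => d.
  by rewrite -val_eqE /= => /negPf->.
rewrite forests_eq0 ?(leq_trans le_ni) ?leq_addl // big1 // => d _.
by rewrite ltn_eqF // (leq_trans (ltn_ord d)).
Qed.

(** Children are not roots, so [m] roots and a vertex of outdegree [i] take at least [m + i]
    vertices. *)
Lemma forest_total_eq0 i m n : n < m + i -> forest_total i m n = 0.
Proof.
elim: n m => [|n IHn] [|m] lt_n; rewrite /forest_total ?big_nil //.
  by rewrite big_seq1 /forest_count big_nil.
rewrite -/(forest_total i m.+1 n.+1) forest_total_sum forests_eq0 // big1 // => d _.
by rewrite IHn // addnAC ltn_addr.
Qed.

Lemma forest_totalS i m n :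
  forest_total i m.+1 n.+1 + size (forests (m + i).+1 n) =
    forest_total i m n + forest_total i m.+2 n.+1 + size (forests (m + i) n).
Proof.
rewrite !forest_total_sum (sum_forestsE (forest_total i)); first by rewrite addSn; lia.
by move=> k lt_nk; rewrite forest_total_eq0 // ltn_addr.
Qed.

(** * Closed formulas *)

Lemma size_forests_diag m : size (forests m m) = 1.
Proof. by elim: m => // m IHm; rewrite size_forestsS IHm forests_eq0. Qed.

(** Ballot numbers as a difference of binomials, with [j.+1] non-root vertices. Pascal's rule gives
    the recurrence; at [m = 0] the two binomials agree by symmetry. *)
Lemma size_forests_bin m j :
  size (forests m (m + j.+1)) + 'C(m + j.*2.+1, j) = 'C(m + j.*2.+1, j.+1).
Proof.
elim: j m => [|j IHj]; elim=> [|m IHm] //.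
- rewrite addSn size_forestsS addn1 size_forests_diag.
  by move: IHm; rewrite !bin0 !bin1 !addn1; lia.
- rewrite !add0n /= -(@bin_sub j.+1.*2.+1 j.+1); last by lia.
  by congr 'C(_, _); lia.
rewrite addSn size_forestsS; move: IHm (IHj m.+2).
have -> : m.+1 + j.+1.*2.+1 = (m + j.*2.+3).+1 by lia.
have -> : m.+2 + j.*2.+1 = m + j.*2.+3 by lia.
have -> : m.+2 + j.+1 = (m + j.+2).+1 by lia.
by rewrite doubleS !binS; lia.
Qed.

Lemma size_forestsE m j :
  (m.+1 + j) * size (forests m.+1 (m.+1 + j)) = m.+1 * 'C(m + j.*2, j).
Proof.
case: j => [|j]; first by rewrite addn0 size_forests_diag bin0.
have := size_forests_bin m.+1 j; have := mul_bin_left (m + j.+1.*2) j.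
have -> : m.+1 + j.*2.+1 = m + j.+1.*2 by lia.
have -> : m + j.+1.*2 - j = m.+1 + j.+1 by lia.
by nia.
Qed.

(** With only [i] non-root vertices, a vertex of outdegree [i] must be a root with all of them as
    children, and any of the [m] roots can be it. *)
Lemma forest_total_diag i m : forest_total i m (m + i) = m.
Proof.
elim: m => [|m IHm].
  by case: i => [|i]; rewrite /forest_total ?big_nil // big_seq1 /forest_count big_nil.
have := forest_totalS i m (m + i).
rewrite IHm size_forests_diag forests_eq0 // [forest_total i m.+2 _]forest_total_eq0 //.
by rewrite -addSn !addn0 addn1.
Qed.

(** The subtraction can truncate only at [l = 0], where the binomial is 1 anyway. The recurrence
    links [(m.+1, l.+1)] to [(m, l.+1)] and [(m.+2, l)], hence the nested inductions. *)
Lemma forest_totalE i m l :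
  forest_total i m (m + i + l) = m * 'C(m + i + l.*2 - 2, l).
Proof.
elim: l m => [|l IHl] m; first by rewrite addn0 forest_total_diag bin0 muln1.
elim: m => [|m IHm]; first by rewrite addnS /forest_total big_nil.
have := forest_totalS i m (m + i + l.+1); move: IHm (IHl m.+2).
have -> : (m + i + l.+1).+1 = m.+1 + i + l.+1 by lia.
have -> : m.+2 + i + l = m.+1 + i + l.+1 by lia.
have -> : m.+2 + i + l.*2 - 2 = m + i + l.*2 by lia.
have -> : m + i + l.+1.*2 - 2 = m + i + l.*2 by lia.
have -> : m.+1 + i + l.+1.*2 - 2 = (m + i + l.*2).+1 by lia.
have := size_forests_bin (m + i) l.
have -> : m + i + l.*2.+1 = (m + i + l.*2).+1 by lia.
rewrite !binS.
(* The forests of [(m + i).+1] trees have [l] non-root vertices, and the difference formula requires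
   at least one. *)
case: l {IHl} => [|l].
  rewrite !addn1 size_forests_diag !bin0; nia.
have := size_forests_bin (m + i).+1 l.
have -> : (m + i).+1 + l.*2.+1 = m + i + l.+1.*2 by lia.
have -> : (m + i).+1 + l.+1 = m + i + l.+2 by lia.
rewrite binS; nia.
Qed.

(** * Cardinality of the set of pairs and integer binomials *)

Local Open Scope classical_set_scope.

Lemma outdegree_pairs_card n m i :
  (outdegree_pairs n m i #=
     `I_((m == i) * size (forests m n) + forest_total i m n))%card.
Proof.
pose pairs :=
  [seq (Node s, v) | s <- forests m n, v <- vertices_of_outdegree i (Node s)].
have -> : outdegree_pairs n m i = [set` [fset x in pairs]%fset].
  apply/seteqP; split=> -[[s] v] /=; rewrite inE /=.
    case=> /= /eqP ne_s /eqP sz_s /mem_vertices_of_outdegree v_s.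
    apply/allpairsPdep; exists s, v; split=> //.
    by rewrite mem_forests sz_s.
  case/allpairsPdep=> u [w [+ w_u [-> ->]]].
  rewrite mem_forests => /andP[/eqP sz /eqP ne].
  by split=> //; apply/mem_vertices_of_outdegree.
apply/card_eq_fsetP; rewrite card_fseq undup_id.
  rewrite size_allpairs_dep sumnE big_map /forest_total -sum1_size big_distrr -big_split /=.
  rewrite [LHS]big_seq [RHS]big_seq; apply: eq_bigr => s.
  by rewrite mem_forests => /andP[/eqP <- _]; rewrite size_vertices_of_outdegree muln1.
apply: allpairs_uniq_dep => [|s _|]; [exact: uniq_forests | exact: uniq_vertices_of_outdegree |].
by move=> [s v] [u w] _ _ /= [-> ->].
Qed.

Lemma binz_eq0 a b : (a < b)%R -> binz a b = 0.
Proof.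
rewrite /binz; case: eqP => [-> | _]; first by rewrite ltxx.
by case: a b => a [] b //= lt_ab; rewrite bin_small.
Qed.

Lemma binzD (b l : nat) : binz (b%:Z + l%:Z)%R b%:Z%R = 'C(b + l, l).
Proof.
rewrite (_ : (b%:Z + l%:Z)%R = Posz (b + l)) // /binz; case: eqP => [[eq_b] | _].
  by have -> : l = 0; [lia | rewrite bin0].
by rewrite -(@bin_sub _ l) ?leq_addl // addnK.
Qed.

Local Open Scope ring_scope.

Theorem theorem9 (n m i : nat) (n_ge1 : (1 <= n)%N) (m_ge1 : (1 <= m)%N) :
  exists2 N : nat, (outdegree_pairs n m i #= `I_N)%card &
    (i <> m ->
       N%:R = m%:R * (binz (2 * n%:Z - m%:Z - i%:Z - 2) (n%:Z - 2))%:R :> rat) /\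
    (i = m ->
       N%:R = m%:R * (binz (2 * n%:Z - 2 * m%:Z - 2) (n%:Z - 2))%:R
              + m%:R / n%:R * (binz (2 * n%:Z - m%:Z - 1) (n%:Z - 1))%:R :> rat).
Proof.
exists ((m == i) * size (forests m n) + forest_total i m n)%N.
  exact: outdegree_pairs_card.
have totalE : forest_total i m n =
    (m * binz (2 * n%:Z - m%:Z - i%:Z - 2) (n%:Z - 2))%N.
  (* The upper index exceeds the lower one by [n - m - i]; both sides vanish when this is
     negative. *)
  have [le_n | lt_n] := leqP (m + i) n; last first.
    by rewrite forest_total_eq0 // binz_eq0 ?muln0 //; lia.
  rewrite -(subnKC le_n) forest_totalE; set l := (n - (m + i))%N; congr (_ * _)%N.
  (* For [n = 1] the binomial is C(-1, -1), which the convention sets to 1. *)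
  have [n_gt1 | n_le1] := ltnP 1 (m + i + l)%N; last first.
    have [-> ->] : m = 1%N /\ i = 0%N by lia.
    by have -> : l = 0%N by lia.
  rewrite (_ : (_ + l)%:Z - 2 = (m + i + l - 2)%N%:Z); last by lia.
  rewrite [X in binz X _](_ : _ = (m + i + l - 2)%N%:Z + l%:Z); last by lia.
  by rewrite binzD; congr 'C(_, _); lia.
have sizeE : n%:R * (size (forests m n))%:R =
    m%:R * (binz (2 * n%:Z - m%:Z - 1) (n%:Z - 1))%:R :> rat.
  rewrite -!natrM; congr _%:R.
  have [le_n | lt_n] := leqP m n; last first.
    by rewrite forests_eq0 // binz_eq0 ?muln0 //; lia.
  case: m m_ge1 le_n {totalE} => // k _ le_n.
  rewrite -{1 2}(subnKC le_n) size_forestsE; set l := (n - k.+1)%N; congr (_ * _)%N.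
  rewrite (_ : n%:Z - 1 = (k + l)%N%:Z); last by lia.
  rewrite [X in binz X _](_ : _ = (k + l)%N%:Z + l%:Z); last by lia.
  by rewrite binzD; congr 'C(_, _); lia.
have n_neq0 : n%:R != 0 :> rat by rewrite pnatr_eq0 -lt0n.
split=> [/eqP|] eq_im.
  by rewrite eq_sym (negPf eq_im) mul0n add0n totalE natrM.
rewrite {1}eq_im eqxx mul1n natrD totalE natrM eq_im addrC; congr (_ * _%:R + _).
  by congr binz; ring.
by rewrite mulrAC -sizeE mulrAC divff // mul1r.
Qed.
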